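(* Let $X_1$, $X_2$, $E_1$, $E_2$ and $F$ be locally convex spaces, $P$, $Q$, $U$ and $V$ be locally convex subsets with dense interior of $X_1$, $X_2$, $E_1$ and $E_2$ respectively, $r,s \in \mathbb{N}_0 \cup \{\infty\}$, $f\colon U \times V \rightarrow F$ a $C^{r,s}$-map, $g_1\colon P\rightarrow U$ a $C^r$-map and $g_2\colon Q \rightarrow V$ a $C^s$-map. Then $$f \circ (g_1 \times g_2)\colon P \times Q \rightarrow F, \quad (p,q) \mapsto f(g_1(p),g_2(q))$$ is a $C^{r,s}$-map.
   Context: Locally convex spaces are real Hausdorff locally convex topological vector spaces. A subset $U$ of a locally convex space $E$ is called locally convex if every $x\in U$ has a convex neighbourhood in $U$. ''With dense interior'' means that the interior $U^\circ$ is dense in $U$. $C^r$-maps: For $f\colon U\to F$ with $U\subseteq E$ open, $D_hf(x):=\lim_{t\to0}t^{-1}(f(x+th)-f(x))$. The map $f$ is $C^r$ if for all $k\in\mathbb{N}_0$ with $k\le r$ the iterated directional derivatives $d^{(k)}f(x,y_1,\dots,y_k):=(D_{y_k}\cdots D_{y_1}f)(x)$ exist and define a continuous map $d^{(k)}f\colon U\times E^k\to F$. If $U$ is a locally convex subset with dense interior, $f\colon U\to F$ is $C^r$ if $f|_{U^\circ}$ is $C^r$ and each $d^{(k)}(f|_{U^\circ})$ extends to a (unique) continuous map $d^{(k)}f\colon U\times E^k\to F$ (with $d^{(0)}f=f$). A map into a subset of a locally convex space is $C^r$ if it is $C^r$ as a map into that space. $C^{r,s}$-maps: For $U\subseteq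 E_1$, $V\subseteq E_2$ open, $f\colon U\times V\to F$ is $C^{r,s}$ if for all $i,j\in\mathbb{N}_0$ with $i\le r$, $j\le s$ the iterated directional derivative $d^{(i,j)}f(x,y,w_1,\dots,w_i,v_1,\dots,v_j):=(D_{(w_i,0)}\cdots D_{(w_1,0)}D_{(0,v_j)}\cdots D_{(0,v_1)}f)(x,y)$ exists everywhere and $d^{(i,j)}f\colon U\times V\times E_1^i\times E_2^j\to F$ is continuous. If $U,V$ are locally convex subsets with dense interior, $f$ is $C^{r,s}$ if $f|_{U^\circ\times V^\circ}$ is $C^{r,s}$ and each $d^{(i,j)}(f|_{U^\circ\times V^\circ})$ extends to a continuous map $d^{(i,j)}f\colon U\times V\times E_1^i\times E_2^j\to F$ (with $d^{(0,0)}f=f$). *)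

(* Defs.v *)
From HB Require Import structures.
From mathcomp Require Import all_boot all_order all_algebra.
From mathcomp Require Import all_classical all_reals all_analysis.
Set Implicit Arguments.
Unset Strict Implicit.
Unset Printing Implicit Defensive.
Import Order.TTheory GRing.Theory Num.Theory.
Import numFieldNormedType.Exports.
Local Open Scope classical_set_scope.
Local Open Scope ring_scope.

(* A map U -> F is represented by a total function on the ambient space whose
   values off U are irrelevant: Cr and Crs depend only on its values on U.
   Cr_open and Crs_open are meant for open sets. *)

(* Orders of differentiability, None standing for infinity. *)
Definition diff_order := option nat.

Definition le_diff_order (k : nat) (r : diff_order) : bool :=
  if r is Some n then (k <= n)%N else true.

Section LocallyConvexSets.
Context {R : realType}.

(* C is a neighbourhood of x in U for the topology induced on U. *)
Definition locally_convex_set (E : tvsType R) (U : set E) : Prop :=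
  forall x, U x ->
    exists C : set E, [/\ C `<=` U, nbhs (x : subspace U) C & convex_set C].

Definition dense_interior (E : tvsType R) (U : set E) : Prop :=
  U `<=` closure U°.

End LocallyConvexSets.

Section DirectionalDerivatives.
Context {R : realType} {E F : tvsType R}.
Implicit Types (f : E -> F) (h x : E) (U : set E) (hs : seq E).

(* The library's derive and derivable are restricted to normed modules. *)
Definition diff_quotient f x h (t : R) : F := t^-1 *: (f (x + t *: h) - f x).

Definition is_dir_derive f x h (l : F) : Prop :=
  diff_quotient f x h @ 0^' --> l.

Definition dir_derivable f x h : Prop := exists l, is_dir_derive f x h l.

(* F is not a pointed type for the library, hence xget rather than lim; the
   default value 0 is taken only where the limit does not exist. *)
Definition dir_derive h f : E -> F :=
  fun x => xget 0 [set l | is_dir_derive f x h l].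

(* For hs = [:: h_1; ...; h_n], this is D_{h_n} ... D_{h_1} f. *)
Fixpoint iter_derive hs f : E -> F :=
  if hs is h :: hs' then iter_derive hs' (dir_derive h f) else f.

Fixpoint iter_derivable U hs f : Prop :=
  if hs is h :: hs' then
    (forall x, U x -> dir_derivable f x h) /\
    iter_derivable U hs' (dir_derive h f)
  else True.

End DirectionalDerivatives.

Section Cr.
Context {R : realType} {E F : tvsType R}.
Implicit Types (f : E -> F) (U : set E) (r : diff_order).

Definition dk k f (z : E * {ptws 'I_k -> E}) : F :=
  iter_derive [seq z.2 i | i : 'I_k] f z.1.

Definition Cr_open r U f : Prop :=
  forall k, le_diff_order k r ->
    (forall y : {ptws 'I_k -> E}, iter_derivable U [seq y i | i : 'I_k] f) /\
    {within U `*` setT, continuous (@dk k f)}.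

Definition Cr r U f : Prop :=
  Cr_open r U° f /\
  forall k, le_diff_order k r ->
    exists df : E * {ptws 'I_k -> E} -> F,
      [/\ {within U `*` setT, continuous df},
          forall x y, U° x -> df (x, y) = dk f (x, y) &
          k = 0%N -> forall x y, U x -> df (x, y) = f x].

End Cr.

Section Crs.
Context {R : realType} {E1 E2 F : tvsType R}.
Implicit Types (f : E1 * E2 -> F) (U : set E1) (V : set E2).
Implicit Types (r s : diff_order).

(* The directions (0, v_1), ..., (0, v_j), (w_1, 0), ..., (w_i, 0), in the
   order in which the derivatives are taken. *)
Definition dij_dirs i j (w : {ptws 'I_i -> E1}) (v : {ptws 'I_j -> E2}) :
    seq (E1 * E2) :=
  [seq (0, v b) | b : 'I_j] ++ [seq (w a, 0) | a : 'I_i].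

Definition dij i j f
    (z : (E1 * E2) * ({ptws 'I_i -> E1} * {ptws 'I_j -> E2})) : F :=
  iter_derive (dij_dirs z.2.1 z.2.2) f z.1.

Definition Crs_open r s U V f : Prop :=
  forall i j, le_diff_order i r -> le_diff_order j s ->
    (forall (w : {ptws 'I_i -> E1}) (v : {ptws 'I_j -> E2}),
        iter_derivable (U `*` V) (dij_dirs w v) f) /\
    {within (U `*` V) `*` setT, continuous (@dij i j f)}.

Definition Crs r s U V f : Prop :=
  Crs_open r s U° V° f /\
  forall i j, le_diff_order i r -> le_diff_order j s ->
    exists df : (E1 * E2) * ({ptws 'I_i -> E1} * {ptws 'I_j -> E2}) -> F,
      [/\ {within (U `*` V) `*` setT, continuous df},
          forall x y u, U° x -> V° y -> df ((x, y), u) = dij f ((x, y), u) &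
          i = 0%N -> j = 0%N ->
            forall x y u, U x -> V y -> df ((x, y), u) = f (x, y)].

End Crs.

(* Main.v *)
Require Import Defs.
From HB Require Import structures.
From mathcomp Require Import all_boot all_order all_algebra.
From mathcomp Require Import all_classical all_reals all_analysis.
From mathcomp Require Import ring lra.
Set Implicit Arguments.
Unset Strict Implicit.
Unset Printing Implicit Defensive.
Import Order.TTheory GRing.Theory Num.Theory.
Import numFieldNormedType.Exports.
Local Open Scope classical_set_scope.
Local Open Scope ring_scope.

(** On the interior of P x Q the iterated derivatives of f o (g1 x g2) are given
by the Faa di Bruno formula: the derivative in the directions v_0, ..., v_{j-1}
of the second variable and then w_0, ..., w_{i-1} of the first one is the sum,
over the set partitions p of {0, ..., i-1} and q of {0, ..., j-1}, of
  d^(|p|,|q|) f (g1 x, g2 y; (d^|B| g1 (x, w_B))_{B in p},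
                             (d^|C| g2 (y, v_C))_{C in q}).
Written with the continuous extensions of the derivatives of f, g1 and g2, the
right-hand side makes sense and is continuous on all of P x Q, so it is at once
the derivative on the interior and its extension.

The formula is proved by induction on j and then on i; each step is a chain rule
in one of the two variables (set_parts_chain_cvg): the new direction either opens
a new block, which comes from differentiating f at the moving base point, or
enters an existing block, because the derivatives of f are multilinear in their
directions (jet_slot_linear).

The obstacle is that g1 and g2 may send interior points of P and Q to boundary
points of U and V, where the derivatives of f are only limits of derivatives at
interior points.  This is where local convexity enters (chord_quotient_cvg): the
chord between two nearby points of U x V lies in a convex neighbourhood, and a
slight shrinking towards an interior point of that neighbourhood pushes the whole
chord into the interior.  There a mean value theorem (mean_value_convex) confines
the difference quotient to any open convex set containing the values of the
derivative along the chord; undoing the shrinking, by continuity the quotient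
along the original chord lies in the closure.  Since F has a base of convex
neighbourhoods and is regular, the quotients converge to the extended derivative.

Derivatives are handled as jets: families of maps indexed by lists of directions,
continuous on the whole set and related by differentiation on its interior. *)

(** * Limits and convex sets in topological vector spaces *)

Section TvsLimits.
Context {R : realType} {T : Type} (G : set_system T) {FG : Filter G}.

Lemma cvg_addv (E : tvsType R) (f g : T -> E) (a b : E) :
  f @ G --> a -> g @ G --> b -> (fun t => f t + g t) @ G --> a + b.
Proof.
move=> fa gb.
have fg : (fun t => (f t, g t)) @ G --> (a, b) by exact: cvg_pair.
exact: (cvg_comp _ _ fg (@add_continuous E (a, b))).
Qed.

Lemma cvg_scalev (E : tvsType R) (k : T -> R) (f : T -> E) (c : R) (a : E) :
  k @ G --> c -> f @ G --> a -> (fun t => k t *: f t) @ G --> c *: a.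
Proof.
move=> kc fa.
have kf : (fun t => (k t, f t) : R^o * E) @ G --> ((c, a) : R^o * E).
  exact: (@cvg_pair _ R^o E G (nbhs (c : R^o)) (nbhs a)).
exact: (cvg_comp _ _ kf (@scale_continuous R E (c, a))).
Qed.

Lemma cvg_oppv (E : tvsType R) (f : T -> E) (a : E) :
  f @ G --> a -> (fun t => - f t) @ G --> - a.
Proof. by move=> fa; exact: (cvg_comp _ _ fa (@opp_continuous E a)). Qed.

Lemma cvg_subv (E : tvsType R) (f g : T -> E) (a b : E) :
  f @ G --> a -> g @ G --> b -> (fun t => f t - g t) @ G --> a - b.
Proof. by move=> fa gb; apply: cvg_addv => //; exact: cvg_oppv. Qed.

Lemma cvg_sumv (E : tvsType R) (I : eqType) (s : seq I) (f : I -> T -> E)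
    (a : I -> E) :
  (forall i, i \in s -> f i @ G --> a i) ->
  (fun t => \sum_(i <- s) f i t) @ G --> \sum_(i <- s) a i.
Proof.
elim: s => [|i s ih] h.
  under eq_fun do rewrite big_nil.
  by rewrite big_nil; exact: cvg_cst.
under eq_fun do rewrite big_cons.
rewrite big_cons; apply: cvg_addv; first by apply: h; exact: mem_head.
by apply: ih => j js; apply: h; rewrite in_cons js orbT.
Qed.

End TvsLimits.

Section ConvexSets.
Context {R : realType} {E : tvsType R}.
Implicit Types (C : set E) (x y : E).

Lemma convex_comb C x y (t : R) : convex_set C -> C x -> C y ->
  0 <= t <= 1 -> C (x + t *: (y - x)).
Proof.
move=> cC Cx Cy /andP[t0 t1].
have := cC y x (Itv01 t0 t1); rewrite !inE => /(_ Cy Cx).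
rewrite /conv /=.
set u := (X in C X -> _); suff -> : x + t *: (y - x) = u by [].
rewrite /u /= scalerBr addrCA; congr (_ + _).
by rewrite /unstable.onem scalerBl scale1r.
Qed.

Lemma nbhs_convex x (A : set E) : nbhs x A ->
  exists C, [/\ open C, convex_set C, C x & C `<=` A].
Proof.
have [B Bc [Bo Bb]] := @locally_convex R E.
move=> /Bb [C [BC Cx] CA]; exists C; split => //; first exact: Bo.
by apply: Bc; rewrite inE.
Qed.

Lemma convex_setI (C D : set E) :
  convex_set C -> convex_set D -> convex_set (C `&` D).
Proof.
move=> cC cD x y t; rewrite !inE => -[Cx Dx] [Cy Dy]; split.
  by apply/set_mem/cC; exact/mem_set.
by apply/set_mem/cD; exact/mem_set.
Qed.

(** The homothety of centre x and ratio e maps C into itself, hence the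
neighbourhood C of c onto a neighbourhood of the image of c inside C. *)
Lemma convex_interior C x c (e : R) : convex_set C -> C x -> C° c ->
  0 < e <= 1 -> C° (x + e *: (c - x)).
Proof.
move=> cC Cx Cc /andP[e0 e1].
have : (fun w => x + e^-1 *: (w - x)) @ (x + e *: (c - x)) --> c.
  rewrite [X in _ --> X](_ : c = x + e^-1 *: ((x + e *: (c - x)) - x)).
    apply: cvg_addv; first exact: cvg_cst.
    apply: cvg_scalev; first exact: cvg_cst.
    by apply: cvg_subv; [exact: cvg_id|exact: cvg_cst].
  rewrite [x + e *: _]addrC addrK scalerA mulVf ?gt_eqF// scale1r.
  by rewrite addrC subrK.
move=> /(_ _ Cc) h; apply: (@filterS _ (nbhs (x + e *: (c - x))) _ _ _ _ h).
move=> w /= Cw.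
have -> : w = x + e *: ((x + e^-1 *: (w - x)) - x).
  rewrite [x + e^-1 *: _]addrC addrK scalerA mulfV ?gt_eqF// scale1r.
  by rewrite addrC subrK.
by apply: convex_comb => //; rewrite e1 ltW.
Qed.

End ConvexSets.

(** * A mean value theorem *)

Section MeanValue.
Context {R : realType} {F : tvsType R}.

Definition slope (g : R -> F) (a b : R) : F := (b - a)^-1 *: (g b - g a).

Lemma slopeC g a b : slope g a b = slope g b a.
Proof.
by rewrite /slope -(opprB a b) -(opprB (g a)) invrN scaleNr scalerN opprK.
Qed.

(** The slope over a concatenation of intervals is a convex combination of the
slopes over the pieces. *)
Lemma slope_cat (N : set F) g a b c : convex_set N -> a < b -> b < c ->
  N (slope g a b) -> N (slope g b c) -> N (slope g a c).
Proof.
move=> cN ab bc Nab Nbc.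
have ac := lt_trans ab bc.
have := @convex_comb _ _ _ _ _ ((c - b) / (c - a)) cN Nab Nbc.
have -> : slope g a b + (c - b) / (c - a) *: (slope g b c - slope g a b)
          = slope g a c.
  rewrite scalerBr addrCA -[X in _ + (X - _)]scale1r -scalerBl /slope !scalerA.
  have -> : (c - b) / (c - a) / (c - b) = (c - a)^-1.
    by field; rewrite !subr_eq0 !gt_eqF.
  have -> : (1 - (c - b) / (c - a)) / (b - a) = (c - a)^-1.
    by field; rewrite !subr_eq0 !gt_eqF.
  by rewrite -scalerDr addrA subrK.
apply; apply/andP; split; first by rewrite divr_ge0 ?subr_ge0 ?ltW.
by rewrite ler_pdivrMr ?subr_gt0// mul1r lerB// ltW.
Qed.

(** Near each point s the slopes of chords with an endpoint at s lie in N, because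
N is open, and such short chords can be concatenated from a to b.  Instead of
extracting a finite subdivision, the proof shows that the supremum of the points
reached from a is b. *)
Lemma mean_value_convex (N : set F) (g g' : R -> F) a b :
  a < b -> open N -> convex_set N ->
  (forall s, a <= s <= b -> N (g' s)) ->
  (forall s, a <= s <= b -> t^-1 *: (g (s + t) - g s) @[t --> 0^'] --> g' s) ->
  N (slope g a b).
Proof.
move=> ab oN cN Ng' gg'.
have loc s : a <= s <= b -> exists2 d, 0 < d &
    forall u, u != s -> `|u - s| < d -> N (slope g s u).
  move=> sab; have /(gg' s sab) : nbhs (g' s) N.
    by apply: open_nbhs_nbhs; split => //; exact: Ng'.
  rewrite /= /nbhs/= => -[d /= d0 dN]; exists d => // u us usd.
  have := dN (u - s); rewrite /= subrKC sub0r normrN subr_eq0; exact.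
pose A := [set u | a <= u <= b /\ (u = a \/ N (slope g a u))].
have Aa : A a by split; [rewrite lexx ltW|left].
have Ab u : A u -> u <= b by case=> /andP[].
have hA : has_sup A by split; [exists a|exists b].
set m := sup A.
have am : a <= m by exact: ub_le_sup hA.2 _ Aa.
have mb : m <= b by exact: ge_sup hA.1 _.
have [|d d0 dN] := loc m; first by rewrite am mb.
have Am : A m.
  split; first by rewrite am mb.
  have [e Ae] := sup_adherent d0 hA; rewrite -/m => me.
  have em : e <= m by exact: ub_le_sup hA.2 _ Ae.
  have [em'|em'] := eqVneq e m; first by rewrite -em'; case: Ae.
  right; have em2 : e < m by rewrite lt_neqAle em'.
  have Nem : N (slope g e m).
    by rewrite slopeC; apply: dN => //; rewrite ltr0_norm ?subr_lt0//; lra.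
  case: (Ae) => /andP[ae _] [<-//|Nae].
  have [->//|ea] := eqVneq a e.
  by apply: (slope_cat cN _ em2 Nae Nem); rewrite lt_neqAle ea.
have mNa u : m < u -> u <= b -> u - m < d -> N (slope g a u).
  move=> mu ub umd.
  have Nmu : N (slope g m u) by apply: dN; rewrite ?gt_eqF// gtr0_norm ?subr_gt0.
  case: Am => _ [<-//|Nam].
  have [->//|ea] := eqVneq a m.
  by apply: (slope_cat cN _ mu Nam Nmu); rewrite lt_neqAle ea.
have [mb'|bm] := ltP m b; last first.
  have -> : b = m by apply/eqP; rewrite eq_le bm mb.
  case: Am => _ [ma|//]; lra.
pose u := Num.min b (m + d / 2).
have mu : m < u by rewrite lt_min mb'/= ltrDl divr_gt0.
have ub : u <= b by rewrite ge_min lexx.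
have : A u.
  split; first by rewrite ub (le_trans am)// ltW.
  right; apply: mNa => //.
  have : u <= m + d / 2 by rewrite ge_min lexx orbT.
  by move: d0; lra.
by move=> /(ub_le_sup hA.2); rewrite leNgt mu.
Qed.

End MeanValue.

(** * Difference quotients up to the boundary *)

Section DifferenceQuotients.
Context {R : realType} {E F : tvsType R}.

(** The maps H t have directional derivatives at interior points only, yet both
ends of the chord may lie on the boundary of S.  The maps, the base point and the
direction all depend on t so that the same statement serves for the motion of the
base point with the remaining arguments of a derivative varying, and for the
additivity of a derivative in its direction. *)
Lemma chord_quotient_cvg (S : set E) (H D : R -> E -> F) (b k : R -> E)
    (c : E) (l : F) :
  locally_convex_set S -> dense_interior S -> S c ->
  b t @[t --> 0^'] --> c -> b t + t *: k t @[t --> 0^'] --> c ->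
  (\forall t \near 0^', S (b t)) -> (\forall t \near 0^', S (b t + t *: k t)) ->
  (forall t z, S z -> H t @ within S (nbhs z) --> H t z) ->
  (forall t z, S° z -> is_dir_derive (H t) z (k t) (D t z)) ->
  (fun p : R * E => D p.1 p.2) @ filter_prod 0^' (within S (nbhs c)) --> l ->
  t^-1 *: (H t (b t + t *: k t) - H t (b t)) @[t --> 0^'] --> l.
Proof.
move=> cS dS Sc bc bkc Sb Sbk Hcont Hder Dl M nM.
have [B nB clB] : exists2 B, nbhs l B & closure B `<=` M := uniform_regular nM.
have [N [oN cN Nl NB]] := nbhs_convex nB.
have /Dl : nbhs l N by exact: open_nbhs_nbhs.
move=> -[[T0 W0] /= [nT0 nW0] TW].
have [C [CS nC cC]] := cS _ Sc.
have {}nC : nbhs c [set z | S z -> C z].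
  by move: nC; rewrite /nbhs /= -nbhs_subspace_in.
have [W [oW cW Wc WW0]] := nbhs_convex nW0.
have nW : nbhs c W by exact: open_nbhs_nbhs.
have nW' : nbhs c (W `&` [set z | S z -> C z]) by exact: filterI.
pose K := C `&` W.
have cK : convex_set K by exact: convex_setI.
have KS : K `<=` S by move=> z [/CS].
have KN t z : T0 t -> K z -> N (D t z).
  move=> T0t Kz; apply: (TW (t, z)); split => //=.
  by apply: WW0; [case: Kz|exact: KS].
(* The point towards which chords in K are shrunk. *)
have [d Kd] : exists d, K° d.
  have /dS /(_ _ (nbhs_interior nW')) [d [Sd Wd]] := Sc.
  exists d; apply: filterS (filterI Sd Wd) => z [Sz [Wz SCz]].
  by split => //; exact: SCz.
suff : \forall t \near (0 : R)^',
  M (t^-1 *: (H t (b t + t *: k t) - H t (b t))) by [].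
near=> t.
have t0 : t != 0 by near: t; exact: nbhs_dnbhs_neq.
have T0t : T0 t by near: t.
have Kx : K (b t).
  have Sbt : S (b t) by near: t.
  have [Wbt SCbt] : (W `&` [set z | S z -> C z]) (b t).
    by near: t; exact: (bc _ nW').
  by split => //; exact: SCbt.
have Ky : K (b t + t *: k t).
  have Sbt : S (b t + t *: k t) by near: t.
  have [Wbt SCbt] : (W `&` [set z | S z -> C z]) (b t + t *: k t).
    by near: t; exact: (bkc _ nW').
  by split => //; exact: SCbt.
move: (b t) (k t) (Hder t) Kx Ky => x kt Htd Kx Ky.
set y := x + t *: kt.
(* The chord shrunk by e has step (1 - e) * t and unchanged direction. *)
have inN e : 0 < e < 1 ->
    N ((1 - e)^-1 *:
       (t^-1 *: (H t (y + e *: (d - y)) - H t (x + e *: (d - x))))).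
  move=> /andP[e0 e1].
  pose xe := x + e *: (d - x); pose T := (1 - e) * t.
  have e1' : 0 < 1 - e by rewrite subr_gt0.
  have T_neq0 : T != 0 by rewrite mulf_neq0// gt_eqF.
  pose g s := H t (xe + s *: kt).
  have seg s : 0 <= s / T <= 1 -> K° (xe + s *: kt).
    move=> sT; have Kz := convex_comb cK Kx Ky sT.
    have := convex_interior cK Kz Kd _.
    move=> /(_ e); rewrite e0 ltW// => /(_ isT).
    have -> : x + s / T *: (y - x) = x + s / T *: (t *: kt).
      by rewrite /y (addrC x (t *: kt)) addrK.
    rewrite opprD addrA scalerBr addrACA !scalerA -scalerBl.
    congr (K° (_ + _ *: _)).
    by rewrite /T; field; rewrite t0 gt_eqF.
  have segN s : 0 <= s / T <= 1 -> N (D t (xe + s *: kt)).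
    by move=> sT; apply: KN => //; apply: interior_subset; exact: seg.
  have segD s : 0 <= s / T <= 1 ->
      u^-1 *: (g (s + u) - g s) @[u --> 0^'] --> D t (xe + s *: kt).
    move=> /seg Ks.
    have -> : (fun u => u^-1 *: (g (s + u) - g s)) =
              diff_quotient (H t) (xe + s *: kt) kt.
      by apply/funext => u; rewrite /diff_quotient /g scalerDl addrA.
    by apply: Htd; exact: filterS KS Ks.
  have -> : (1 - e)^-1 *:
      (t^-1 *: (H t (y + e *: (d - y)) - H t (x + e *: (d - x)))) = slope g 0 T.
    rewrite scalerA -invfM mulrC -/T mulrC /slope subr0 /g scale0r addr0 -/xe.
    congr (_ *: (H t _ - _)); rewrite /y /xe /T.
    by rewrite opprD addrA scalerBr addrACA scalerA -scalerBl mulrBl mul1r.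
  have [T0'|T0'] := ltP 0 T.
    apply: (@mean_value_convex _ _ N g (fun s => D t (xe + s *: kt))) => // s.
    - move=> /andP[s0 sT]; apply: segN.
      by rewrite divr_ge0 ?(ltW T0')// ler_pdivrMr ?mul1r.
    - move=> /andP[s0 sT]; apply: segD.
      by rewrite divr_ge0 ?(ltW T0')// ler_pdivrMr ?mul1r.
  have {}T0' : T < 0 by rewrite lt_neqAle T_neq0.
  rewrite slopeC.
  apply: (@mean_value_convex _ _ N g (fun s => D t (xe + s *: kt))) => // s.
  - move=> /andP[s0 sT]; apply: segN.
    by rewrite mulr_le0 ?invr_le0 ?(ltW T0')//= ler_ndivrMr ?mul1r.
  - move=> /andP[s0 sT]; apply: segD.
    by rewrite mulr_le0 ?invr_le0 ?(ltW T0')//= ler_ndivrMr ?mul1r.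
have near01 : \forall e \near (0:R)^'+, 0 < e < 1.
  near=> e; apply/andP; split; near: e; first exact: nbhs_right_gt.
  exact: nbhs_right_lt.
have shrink z : K z -> H t (z + e *: (d - z)) @[e --> 0^'+] --> H t z.
  move=> Kz.
  apply: (cvg_comp (fun e => z + e *: (d - z)) (H t) _ (Hcont t z (KS _ Kz))).
  move=> V; rewrite /within /= => nV.
  have lim : z + e *: (d - z) @[e --> 0^'+] --> z.
    rewrite -[X in _ --> X]addr0 -(scale0r (d - z)); apply: cvg_addv.
      exact: cvg_cst.
    apply: cvg_scalev; last exact: cvg_cst.
    exact: cvg_at_right_filter.
  have SV0 : \forall e \near (0:R)^'+,
      S (z + e *: (d - z)) -> V (z + e *: (d - z)).
    exact: (lim _ nV).
  apply: (filterS _ (filterI SV0 near01)) => e /= [SV e01].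
  apply: SV; apply: KS; apply: convex_comb => //; first exact: interior_subset.
  by case/andP: e01 => e0 e1; rewrite !ltW.
have lim : (1 - e)^-1 *:
    (t^-1 *: (H t (y + e *: (d - y)) - H t (x + e *: (d - x))))
    @[e --> 0^'+] --> t^-1 *: (H t y - H t x).
  rewrite -[X in _ --> X]scale1r -[X in _ --> X *: _]invr1; apply: cvg_scalev.
    apply: cvgV; first by rewrite oner_neq0.
    rewrite -[X in _ --> X](subr0 1); apply: cvgB; first exact: cvg_cst.
    exact: cvg_at_right_filter.
  apply: cvg_scalev; first exact: cvg_cst.
  by apply: cvg_subv; exact: shrink.
apply: clB => V nV.
have {}nV : \forall e \near (0:R)^'+, V ((1 - e)^-1 *:
    (t^-1 *: (H t (y + e *: (d - y)) - H t (x + e *: (d - x))))).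
  exact: (lim _ nV).
have [e [Ve e01]] := filter_ex (filterI nV near01).
by eexists; split; [exact/NB/inN/e01|exact: Ve].
Unshelve. all: by end_near. Qed.

End DifferenceQuotients.

(** * Jets *)

Lemma le_diff_orderW m n r : (m <= n)%N -> le_diff_order n r -> le_diff_order m r.
Proof. by case: r => //= k; exact: leq_trans. Qed.

Section SequenceLimits.
Context {R : realType} {E : tvsType R} {T : Type}.
Implicit Types (G : set_system T) (l m : T -> seq E).

(** Convergence of lists of fixed length in the product topology; both lists
take the default value 0 beyond their common length. *)
Definition cvg_seq G l (l0 : seq E) : Prop :=
  (forall t, size (l t) = size l0) /\
  forall i, (fun t => nth 0 (l t) i) @ G --> nth 0 l0 i.

Lemma cvg_seq_cst G {FG : Filter G} (l0 : seq E) : cvg_seq G (fun=> l0) l0.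
Proof. by split => // i; exact: cvg_cst. Qed.

Lemma cvg_seq_cat G {FG : Filter G} l (l0 : seq E) m (m0 : seq E) :
  cvg_seq G l l0 -> cvg_seq G m m0 ->
  cvg_seq G (fun t => l t ++ m t) (l0 ++ m0).
Proof.
move=> [sl cl] [sm cm]; split => [t|i]; first by rewrite !size_cat sl sm.
rewrite nth_cat; under eq_fun do rewrite nth_cat sl.
by case: ifP => _; [exact: cl|exact: cm].
Qed.

Lemma cvg_seq_cons G {FG : Filter G} l (l0 : seq E) (k : T -> E) k0 :
  k @ G --> k0 -> cvg_seq G l l0 -> cvg_seq G (fun t => k t :: l t) (k0 :: l0).
Proof. by move=> kk [sl cl]; split => [t|[|i]] //=; rewrite sl. Qed.

Lemma cvg_seq_rcons G {FG : Filter G} l (l0 : seq E) (k : T -> E) k0 :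
  k @ G --> k0 -> cvg_seq G l l0 ->
  cvg_seq G (fun t => rcons (l t) (k t)) (rcons l0 k0).
Proof.
move=> kk cl; under eq_fun do rewrite -cats1.
rewrite -cats1; apply: cvg_seq_cat => //; apply: cvg_seq_cons => //.
exact: cvg_seq_cst.
Qed.

Lemma cvg_seq_map G {FG : Filter G} (I : eqType) (s : seq I) (c : I -> T -> E)
    (c0 : I -> E) :
  (forall i, i \in s -> c i @ G --> c0 i) ->
  cvg_seq G (fun t => [seq c i t | i <- s]) [seq c0 i | i <- s].
Proof.
elim: s => [|i s ih] h /=; first exact: cvg_seq_cst.
apply: cvg_seq_cons; first by apply: h; exact: mem_head.
by apply: ih => j js; apply: h; rewrite in_cons js orbT.
Qed.

End SequenceLimits.

Section DirectionalDerivatives.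
Context {R : realType} {E F : tvsType R}.
Implicit Types (f : E -> F) (S : set E).

Lemma cvg_shift_dir (x h : E) : x + t *: h @[t --> (0 : R)^'] --> x.
Proof.
rewrite -[X in _ --> X]addr0 -(scale0r h); apply: cvg_addv; first exact: cvg_cst.
apply: cvg_scalev; last exact: cvg_cst.
exact: (@nbhs_dnbhs R 0).
Qed.

Lemma near_shift_dir S (x h : E) :
  S° x -> \forall t \near (0 : R)^', S (x + t *: h).
Proof. by move=> Sx; exact: (@cvg_shift_dir x h _ Sx). Qed.

Hypothesis hF : hausdorff_space F.

Lemma is_dir_derive_unique f x h l l' :
  is_dir_derive f x h l -> is_dir_derive f x h l' -> l = l'.
Proof. exact: (cvg_unique hF). Qed.

Lemma is_dir_derive_near S f g x h l : S° x -> (forall z, S z -> f z = g z) ->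
  is_dir_derive f x h l -> is_dir_derive g x h l.
Proof.
move=> Sx fg; apply: cvg_trans; apply: near_eq_cvg.
have := near_shift_dir h Sx; apply: filterS => t St.
by rewrite /diff_quotient fg// fg//; exact: interior_subset.
Qed.

Lemma is_dir_deriveZ f x h l a : a != 0 ->
  is_dir_derive f x h l -> is_dir_derive f x (a *: h) (a *: l).
Proof.
move=> a0 fl; rewrite /is_dir_derive.
have -> : diff_quotient f x (a *: h) = fun t => a *: diff_quotient f x h (t * a).
  apply/funext => t; rewrite /diff_quotient !scalerA invfM.
  by rewrite (mulrC a) -mulrA mulVf// mulr1.
apply: cvg_scalev; first exact: cvg_cst.
apply: (cvg_comp (fun t => t * a) (diff_quotient f x h) _ fl).
move=> V [d /= d0 dV]; exists (d / `|a|); rewrite /= ?divr_gt0 ?normr_gt0//.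
move=> t /=; rewrite sub0r normrN => td t0; apply: dV; rewrite /= ?mulf_neq0//.
by rewrite sub0r normrN normrM -ltr_pdivlMr ?normr_gt0.
Qed.

End DirectionalDerivatives.

Section Jets.
Context {R : realType} {K E F : tvsType R}.

(** J l z stands for the iterated derivative at z, in the directions i h for h in l,
of the map J [::]; i embeds the space of directions, e.g. as one factor of a
product.  The derivatives exist on the interior of S and extend continuously to
S.  Continuity is expressed along arbitrary filters because the arguments
are lists, whose entries vary together with the point. *)
Record jet (i : K -> E) (S : set E) (r : diff_order) (J : seq K -> E -> F) : Prop :=
  Jet {
  jet_cvg : forall (T : Type) (G : set_system T), Filter G ->
    forall (l : T -> seq K) l0 (z : T -> E) z0, le_diff_order (size l0) r ->
    cvg_seq G l l0 -> z @ G --> z0 -> (\forall t \near G, S (z t)) -> S z0 ->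
    J (l t) (z t) @[t --> G] --> J l0 z0;
  jet_derive : forall l k z, le_diff_order (size l).+1 r -> S° z ->
    is_dir_derive (J l) z (i k) (J (rcons l k) z) }.

Context (i : K -> E) (S : set E) (r : diff_order) (J : seq K -> E -> F).
Hypothesis hF : hausdorff_space F.
Hypothesis cS : locally_convex_set S.
Hypothesis dS : dense_interior S.
Hypothesis iD : {morph i : x y / x + y}.
Hypothesis iZ : forall a, {morph i : x / a *: x}.
Hypothesis ic : continuous i.
Hypothesis jJ : jet i S r J.

Lemma jet_chord_cvg (l : R -> seq K) l0 (b : R -> E) c (k : R -> K) k0 :
  le_diff_order (size l0).+1 r -> cvg_seq 0^' l l0 -> k t @[t --> 0^'] --> k0 ->
  S c -> b t @[t --> 0^'] --> c ->
  (\forall t \near 0^', S (b t)) ->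
  (\forall t \near 0^', S (b t + t *: i (k t))) ->
  t^-1 *: (J (l t) (b t + t *: i (k t)) - J (l t) (b t)) @[t --> 0^']
    --> J (rcons l0 k0) c.
Proof.
move=> rl ll kk Sc bc Sb Sbk.
have rl' : le_diff_order (size l0) r by exact: le_diff_orderW rl.
apply: (@chord_quotient_cvg _ _ _ S (fun t => J (l t))
  (fun t => J (rcons (l t) (k t))) b (i \o k) c) => //.
- rewrite -[X in _ --> X]addr0 -(scale0r (i k0)); apply: cvg_addv => //.
  apply: cvg_scalev; first exact: (@nbhs_dnbhs R 0).
  by apply: (cvg_comp k i kk); exact: ic.
- move=> t z Sz; apply: (jet_cvg jJ) => //.
  + by rewrite ll.1.
  + exact: cvg_seq_cst.
  + exact: cvg_within.
  + exact: withinT.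
- by move=> t z Sz; apply: (jet_derive jJ) => //; rewrite ll.1.
- apply: (@jet_cvg _ _ _ _ jJ _ _ _ (fun p => rcons (l p.1) (k p.1)) _ snd) => //.
  + by rewrite size_rcons.
  + apply: cvg_seq_rcons; first exact: (cvg_comp _ _ cvg_fst kk).
    by split => [p|j]; [rewrite ll.1|exact: (cvg_comp _ _ cvg_fst (ll.2 j))].
  + by apply: cvg_trans; [exact: cvg_snd|exact: cvg_within].
  + have SS : within S (nbhs c) S by exact: withinT.
    exact: (@cvg_snd _ _ _ _ _ S SS).
Qed.

(** A linear relation in the last direction persists when further directions are
added, since differentiation is linear, and it passes from the interior to S by
density and continuity. *)
Lemma jet_slot_tail (l : seq K) (k k1 k2 : K) (a : R) :
  (forall z, S° z ->
    J (rcons l k) z = a *: J (rcons l k1) z + J (rcons l k2) z) ->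
  forall m z, le_diff_order (size l + size m).+1 r -> S z ->
  J (l ++ k :: m) z = a *: J (l ++ k1 :: m) z + J (l ++ k2 :: m) z.
Proof.
move=> base m.
have inner : le_diff_order (size l + size m).+1 r -> forall z, S° z ->
    J (l ++ k :: m) z = a *: J (l ++ k1 :: m) z + J (l ++ k2 :: m) z.
  elim/last_ind: m => [|m h ih] rm z Sz; first by rewrite !cats1; exact: base.
  have Sz' : S°° z by exact: nbhs_interior.
  rewrite size_rcons addnS in rm.
  have {}ih := ih (le_diff_orderW (leqnSn _) rm).
  have der k' : is_dir_derive (J (l ++ k' :: m)) z (i h)
      (J (l ++ k' :: rcons m h) z).
    rewrite -rcons_cons -rcons_cat; apply: (jet_derive jJ) => //.
    by rewrite size_cat /= addnS.
  apply: (is_dir_derive_unique hF (der k)).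
  apply: (@is_dir_derive_near _ _ _ (S°)
    (fun z => a *: J (l ++ k1 :: m) z + J (l ++ k2 :: m) z)) => //.
    by move=> w Sw; rewrite ih.
  rewrite /is_dir_derive.
  have -> : diff_quotient
      (fun z => a *: J (l ++ k1 :: m) z + J (l ++ k2 :: m) z) z (i h)
     = fun t => a *: diff_quotient (J (l ++ k1 :: m)) z (i h) t
            + diff_quotient (J (l ++ k2 :: m)) z (i h) t.
    apply/funext => t; rewrite /diff_quotient.
    rewrite [in RHS]scalerA mulrC -[in RHS]scalerA -[in RHS]scalerDr.
    by congr (_ *: _); rewrite scalerBr opprD addrACA.
  by apply: cvg_addv; [apply: cvg_scalev; [exact: cvg_cst|exact: der]|exact: der].
move=> z rm Sz; have {}inner := inner rm.
pose G := within S° (nbhs z).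
have PG : ProperFilter G by apply: within_nbhs_proper; exact: dS.
have lim k' : J (l ++ k' :: m) w @[w --> G] --> J (l ++ k' :: m) z.
  apply: (jet_cvg jJ) => //.
  + by rewrite size_cat /= addnS.
  + exact: cvg_seq_cst.
  + exact: cvg_within.
  + by apply: filterS (withinT _ _) => w; exact: interior_subset.
apply: (cvg_unique hF (lim k)).
have : a *: J (l ++ k1 :: m) w + J (l ++ k2 :: m) w @[w --> G] -->
    a *: J (l ++ k1 :: m) z + J (l ++ k2 :: m) z.
  by apply: cvg_addv => //; apply: cvg_scalev => //; exact: cvg_cst.
apply: cvg_trans; apply: near_eq_cvg.
by apply: filterS (withinT _ _) => w Sw; rewrite inner.
Qed.

(** Homogeneity is a change of variable in the difference quotient.  For additivity
the increment along a k1 + k2 is split into one along k2 and one along a k1; the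
base point of the latter moves, hence the appeal to jet_chord_cvg. *)
Lemma jet_slot_linear (l m : seq K) (a : R) (k1 k2 : K) z : a != 0 ->
  le_diff_order (size l + size m).+1 r -> S z ->
  J (l ++ (a *: k1 + k2) :: m) z = a *: J (l ++ k1 :: m) z + J (l ++ k2 :: m) z.
Proof.
move=> a0 rm Sz.
have rl : le_diff_order (size l).+1 r.
  by apply: le_diff_orderW rm; rewrite ltnS leq_addr.
apply: jet_slot_tail => // {rm Sz}z Sz.
have der k : is_dir_derive (J l) z (i k) (J (rcons l k) z).
  by apply: (jet_derive jJ).
have iE : i (a *: k1 + k2) = a *: i k1 + i k2 by rewrite iD iZ.
apply: (is_dir_derive_unique hF (der _)).
have -> : a *: J (rcons l k1) z = J (rcons l (a *: k1)) z.
  apply: (is_dir_derive_unique hF (is_dir_deriveZ a0 (der k1))).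
  by rewrite -iZ; exact: der.
have : diff_quotient (J l) z (i k2) t +
  t^-1 *: (J l ((z + t *: i k2) + t *: i (a *: k1)) - J l (z + t *: i k2))
  @[t --> 0^'] --> J (rcons l k2) z + J (rcons l (a *: k1)) z.
  apply: cvg_addv; first exact: der.
  apply: (@jet_chord_cvg (fun=> l) l (fun t => z + t *: i k2) z
    (fun=> a *: k1)) => //.
  - exact: cvg_seq_cst.
  - exact: cvg_cst.
  - exact: interior_subset.
  - exact: cvg_shift_dir.
  - exact: near_shift_dir.
  - have := near_shift_dir (i (a *: k1 + k2)) Sz; apply: filterS => t.
    by rewrite iE scalerDr addrA addrAC iZ.
rewrite addrC; apply: cvg_trans; apply: near_eq_cvg; apply: nearW => t.
rewrite /diff_quotient -scalerDr; congr (_ *: _).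
rewrite [LHS]addrC addrA subrK; congr (J l _ - _).
by rewrite iE scalerDr iZ addrA addrAC.
Qed.

End Jets.

(** * The chain rule along set partitions *)

Section SetPartitions.

Fixpoint append_block (k : nat) (p : seq (seq nat)) : seq (seq (seq nat)) :=
  if p is B :: q then
    (rcons B k :: q) :: [seq B :: q' | q' <- append_block k q]
  else [::].

(** The set partitions of {0, ..., n-1}, each listed once: k = n-1 is either alone
or in one of the blocks of a partition of {0, ..., k-1}. *)
Fixpoint set_parts (n : nat) : seq (seq (seq nat)) :=
  if n is k.+1 then
    flatten [seq rcons p [:: k] :: append_block k p | p <- set_parts k]
  else [:: [::]].

Lemma append_block_bound k p q : q \in append_block k p ->
  (forall B, B \in p -> (size B <= k)%N) ->
  size q = size p /\ (forall B, B \in q -> (size B <= k.+1)%N).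
Proof.
elim: p q => [//|B p ih] q /=; rewrite in_cons.
move=> /orP[/eqP -> h|/mapP[q' qq' ->] h].
  split => // C; rewrite in_cons => /orP[/eqP ->|Cp].
    by rewrite size_rcons ltnS h ?mem_head.
  by rewrite leqW// h// in_cons Cp orbT.
have [|sq bq] := ih _ qq'; first by move=> C Cp; rewrite h// in_cons Cp orbT.
split => [|C] /=; first by rewrite sq.
rewrite in_cons => /orP[/eqP ->|/bq//].
by rewrite leqW// h ?mem_head.
Qed.

Lemma set_parts_bound n p : p \in set_parts n ->
  (size p <= n)%N /\ (forall B, B \in p -> (size B <= n)%N).
Proof.
elim: n p => [|n ih] p /=; first by rewrite inE => /eqP ->.
move=> /flattenP[s /mapP[q qn ->]]; have [sq bq] := ih _ qn.
rewrite in_cons => /orP[/eqP ->|pq].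
  split => [|B]; first by rewrite size_rcons.
  rewrite mem_rcons in_cons => /orP[/eqP -> //|/bq]; exact: leqW.
by have [-> bp] := append_block_bound pq bq; split => //; rewrite leqW.
Qed.

End SetPartitions.

Section FaaDiBruno.
Context {R : realType} {K E F : tvsType R}.
Context (i : K -> E) (S : set E) (r : diff_order) (J : seq K -> E -> F).
Hypothesis hF : hausdorff_space F.
Hypothesis cS : locally_convex_set S.
Hypothesis dS : dense_interior S.
Hypothesis iD : {morph i : x y / x + y}.
Hypothesis iZ : forall a, {morph i : x / a *: x}.
Hypothesis ic : continuous i.
Hypothesis jJ : jet i S r J.

(** The curve c B is a derivative of the inner map along a line, taken in the
directions listed in B; k is the direction of the line, so that
differentiating c B appends k to B. *)
Context (k : nat) (c : seq nat -> R -> K).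
Hypothesis kr : le_diff_order k.+1 r.
Hypothesis cder : forall B, (size B <= k)%N ->
  t^-1 *: (c B t - c B 0) @[t --> 0^'] --> c (rcons B k) 0.

Let c_cvg B : (size B <= k)%N -> c B t @[t --> 0^'] --> c B 0.
Proof.
move=> Bk.
have : c B 0 + t *: (t^-1 *: (c B t - c B 0)) @[t --> 0^'] --> c B 0.
  rewrite -[X in _ --> X]addr0 -(scale0r (c (rcons B k) 0)).
  apply: cvg_addv; first exact: cvg_cst.
  by apply: cvg_scalev; [exact: (@nbhs_dnbhs R 0)|exact: cder].
apply: cvg_trans; apply: near_eq_cvg.
apply: filterS (nbhs_dnbhs_neq (0 : R)) => t t0.
by rewrite scalerA mulfV// scale1r addrC subrK.
Qed.

Let cs_cvg p : (forall B, B \in p -> (size B <= k)%N) ->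
  cvg_seq 0^' (fun t => [seq c B t | B <- p]) [seq c B 0 | B <- p].
Proof. by move=> bp; apply: cvg_seq_map => B Bp; apply/c_cvg/bp. Qed.

(** The product rule for the directions, which move one after the other from c B 0
to c B t: pre holds the blocks whose directions have already moved. *)
Lemma jet_slots_cvg pre p x : S x -> (size pre + size p <= k.+1)%N ->
  (forall B, B \in pre ++ p -> (size B <= k)%N) ->
  t^-1 *: (J [seq c B t | B <- pre ++ p] x
           - J ([seq c B t | B <- pre] ++ [seq c B 0 | B <- p]) x) @[t --> 0^']
  --> \sum_(q <- append_block k p) J [seq c B 0 | B <- pre ++ q] x.
Proof.
move=> Sx; elim: p pre => [|B p ih] pre szp bp.
  rewrite /= big_nil.
  by under eq_fun do rewrite !cats0 subrr scaler0; exact: cvg_cst.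
rewrite /= big_cons big_map addrC.
have -> : \sum_(q <- append_block k p) J [seq c B0 0 | B0 <- pre ++ B :: q] x
        = \sum_(q <- append_block k p) J [seq c B0 0 | B0 <- rcons pre B ++ q] x.
  by apply: eq_bigr => q _; rewrite cat_rcons.
have szp' : (size pre + size p).+1 = (size pre + size (B :: p))%N by rewrite addnS.
have bB : (size B <= k)%N by apply: bp; rewrite mem_cat mem_head orbT.
have bpre C : C \in pre -> (size C <= k)%N.
  by move=> Cp; apply: bp; rewrite mem_cat Cp.
have := ih (rcons pre B).
rewrite size_rcons addSnnS cat_rcons => /(_ szp bp) lim1.
have lim2 : J ([seq c C t | C <- pre] ++
      t^-1 *: (c B t - c B 0) :: [seq c C 0 | C <- p]) x
    @[t --> 0^'] --> J [seq c C 0 | C <- pre ++ rcons B k :: p] x.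
  rewrite map_cat /=.
  apply: (@jet_cvg _ _ _ _ _ _ _ _ jJ _ _ _
    (fun t => [seq c C t | C <- pre] ++
      t^-1 *: (c B t - c B 0) :: [seq c C 0 | C <- p])
    _ (fun=> x)) => //.
  - by rewrite size_cat /= !size_map; apply: le_diff_orderW kr.
  - apply: cvg_seq_cat; first exact: cs_cvg.
    by apply: cvg_seq_cons; [exact: cder|exact: cvg_seq_cst].
  - exact: cvg_cst.
  - exact: nearW.
apply: cvg_trans (cvg_addv lim1 lim2); apply: near_eq_cvg.
apply: filterS (nbhs_dnbhs_neq (0 : R)) => t t0.
have -> : J ([seq c C t | C <- pre] ++
      t^-1 *: (c B t - c B 0) :: [seq c C 0 | C <- p]) x =
  t^-1 *: (J ([seq c C t | C <- pre] ++ c B t :: [seq c C 0 | C <- p]) x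
         - J ([seq c C t | C <- pre] ++ c B 0 :: [seq c C 0 | C <- p]) x).
  rewrite -{2}(subrK (c B 0) (c B t)) -[X in (X + c B 0)](scale1r).
  rewrite -(mulfV t0) -scalerA.
  rewrite (jet_slot_linear hF cS dS iD iZ ic jJ)//.
    by rewrite addrK scalerA mulVf// scale1r.
  by rewrite !size_map; apply: le_diff_orderW kr; rewrite szp'.
by rewrite -scalerDr map_rcons !cat_rcons addrA subrK.
Qed.

(** The new block [:: k] comes from the motion of the base point, the partitions in
append_block k p from the motion of the directions. *)
Lemma set_parts_chain_cvg (e : E) :
  (\forall t \near (0 : R)^', S (e + i (c [::] t))) -> S (e + i (c [::] 0)) ->
  t^-1 *: (\sum_(p <- set_parts k) J [seq c B t | B <- p] (e + i (c [::] t))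
         - \sum_(p <- set_parts k) J [seq c B 0 | B <- p] (e + i (c [::] 0)))
    @[t --> 0^'] -->
  \sum_(p <- set_parts k.+1) J [seq c B 0 | B <- p] (e + i (c [::] 0)).
Proof.
move=> St S0; rewrite /= big_flatten /= big_map.
under eq_fun do rewrite -sumrB scaler_sumr.
apply: (@cvg_sumv _ _ _ _ _ _ _ (fun p t => t^-1 *:
  (J [seq c B t | B <- p] (e + i (c [::] t))
   - J [seq c B 0 | B <- p] (e + i (c [::] 0))))).
move=> p pk; have [sp bp] := set_parts_bound pk.
rewrite big_cons map_rcons.
pose kk t := t^-1 *: (c [::] t - c [::] 0).
have kkE t : t != 0 -> e + i (c [::] 0) + t *: i (kk t) = e + i (c [::] t).
  move=> t0; rewrite -iZ scalerA mulfV// scale1r -addrA -iD.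
  by rewrite (addrC (c [::] 0)) subrK.
have lim2 := jet_slots_cvg (pre := [::]) S0 (leqW sp) bp.
have : t^-1 *: (J [seq c B t | B <- p] (e + i (c [::] 0) + t *: i (kk t))
             - J [seq c B t | B <- p] (e + i (c [::] 0))) @[t --> 0^'] -->
   J (rcons [seq c B 0 | B <- p] (c [:: k] 0)) (e + i (c [::] 0)).
  apply: (jet_chord_cvg (b := fun=> e + i (c [::] 0)) cS dS ic jJ) => //.
  - by rewrite size_map; exact: le_diff_orderW kr.
  - exact: cs_cvg.
  - exact: cder.
  - exact: cvg_cst.
  - exact: nearW.
  - by apply: filterS2 (nbhs_dnbhs_neq (0 : R)) St => t t0; rewrite kkE.
move=> lim1.
apply: cvg_trans (cvg_addv lim1 lim2); apply: near_eq_cvg.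
apply: filterS (nbhs_dnbhs_neq (0 : R)) => t t0.
by rewrite kkE// -scalerDr addrA subrK.
Qed.

End FaaDiBruno.

(** * Jets of differentiable maps *)

Section IteratedDerivatives.
Context {R : realType} {E F : tvsType R}.
Implicit Types (f g : E -> F) (O : set E) (hs : seq E).

Lemma iter_derive_rcons hs h f :
  iter_derive (rcons hs h) f = dir_derive h (iter_derive hs f).
Proof. by elim: hs f => //= k hs ih f; rewrite ih. Qed.

Lemma iter_derivable_rcons O hs h f : iter_derivable O (rcons hs h) f <->
  iter_derivable O hs f /\
  (forall x, O x -> dir_derivable (iter_derive hs f) x h).
Proof.
elim: hs f => [|k hs ih] f /=; first by split=> [[? _]|[_ ?]].
by rewrite ih; split=> [[? []]|[[]]].
Qed.

Lemma dir_deriveP f x h : dir_derivable f x h ->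
  is_dir_derive f x h (dir_derive h f x).
Proof.
move=> [l fl]; rewrite /dir_derive.
by apply: (@xgetPex _ 0 (is_dir_derive f x h)); exists l.
Qed.

(** The form in which each step of the induction is used: on an open set the
iterated derivative may be replaced by any formula g for it. *)
Lemma iter_derive_step O hs h f g dg : hausdorff_space F -> open O ->
  iter_derivable O hs f -> (forall x, O x -> iter_derive hs f x = g x) ->
  (forall x, O x -> is_dir_derive g x h (dg x)) ->
  iter_derivable O (rcons hs h) f /\
  (forall x, O x -> iter_derive (rcons hs h) f x = dg x).
Proof.
move=> hF oO fO fg gdg.
have der x : O x -> is_dir_derive (iter_derive hs f) x h (dg x).
  move=> Ox; apply: (@is_dir_derive_near _ _ _ O g) (gdg x Ox).
    exact: open_nbhs_nbhs.
  by move=> z Oz; rewrite fg.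
split.
  apply/iter_derivable_rcons; split => // x Ox.
  by exists (dg x); exact: der.
move=> x Ox; rewrite iter_derive_rcons.
apply: (is_dir_derive_unique hF _ (der _ Ox)).
by apply: dir_deriveP; exists (dg x); exact: der.
Qed.

End IteratedDerivatives.

Lemma map_nth_ord (T T' : Type) (x0 : T) (h : T -> T') (l : seq T) :
  [seq h (nth x0 l i) | i : 'I_(size l)] = map h l.
Proof.
rewrite -[in RHS](mkseq_nth x0 l) /mkseq -val_enum_ord -!map_comp.
by rewrite /image_mem enumT.
Qed.

Lemma ptws_cvg (E : topologicalType) (I T : Type) (G : set_system T)
    {FG : Filter G}
    (w : T -> {ptws I -> E}) (w0 : {ptws I -> E}) :
  (forall a, w t a @[t --> G] --> w0 a) -> w t @[t --> G] --> w0.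
Proof.
move=> h; apply/cvg_sup => a; apply/cvg_image.
  by rewrite eqEsubset; split=> v // _; exists (cst v).
move=> W /(h a) Q; exists (@^~ a @^-1` W) => //.
by rewrite eqEsubset; split => [j [? + <-//]|j Wj]; exists (fun _ => j).
Qed.

Lemma choice_dep (I : Type) (T : I -> Type) (Q : forall i, T i -> Prop) :
  (forall i, exists x, Q i x) -> exists f : forall i, T i, forall i, Q i (f i).
Proof. by move=> h; exists (fun i => sval (cid (h i))) => i; exact: svalP. Qed.

Section CrJet.
Context {R : realType} {X E : tvsType R}.

Lemma cvg_within_cvg (U V : topologicalType) (A : set U) (f : U -> V) (T : Type)
    (G : set_system T) {FG : Filter G} (u : T -> U) u0 :
  {within A, continuous f} -> A u0 -> u t @[t --> G] --> u0 ->
  (\forall t \near G, A (u t)) -> f (u t) @[t --> G] --> f u0.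
Proof.
move=> /subspace_continuousP cf Au0 uu Au.
apply: (cvg_comp u f _ (cf _ Au0)) => B /uu uB.
by apply: filterS2 Au uB => t /= At; apply.
Qed.

Lemma Cr_jet (r : diff_order) (P : set X) (g : X -> E) : Cr r P g ->
  exists2 G : seq X -> X -> E, jet id P r G & forall p, P p -> G [::] p = g p.
Proof.
move=> [go gx].
have {}gx k : exists df : X * {ptws 'I_k -> X} -> E, le_diff_order k r ->
   [/\ {within P `*` setT, continuous df},
       forall x y, P° x -> df (x, y) = dk g (x, y) &
       k = 0%N -> forall x y, P x -> df (x, y) = g x].
  have [kr|kr] := boolP (le_diff_order k r); last by exists (fun=> 0).
  by have [df dfP] := gx k kr; exists df.
have [df dfP] := choice_dep gx.
pose G l x := df (size l) (x, fun a : 'I_(size l) => nth 0 l a).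
have Gint l x : le_diff_order (size l) r -> P° x -> G l x = iter_derive l g x.
  move=> lr Px; have [_ + _] := dfP _ lr => /(_ x _ Px) => dfE.
  by rewrite /G dfE /dk /= (map_nth_ord 0 id) map_id.
have Gder l : le_diff_order (size l) r -> iter_derivable P° l g.
  move=> lr; have [/(_ (fun a : 'I_(size l) => nth 0 l a)) + _] := go _ lr.
  by rewrite (map_nth_ord 0 id) map_id.
exists G; last first.
  move=> p Pp; have [|_ _ h] := dfP 0%N; last by rewrite /G /= h.
  by case: r {dfP Gint Gder go gx}.
split.
- move=> T FF FFF l l0 z z0 l0r [sl cl] zz Pz Pz0.
  rewrite /G; under eq_fun do rewrite sl.
  have [cdf _ _] := dfP _ l0r.
  pose L t : {ptws 'I_(size l0) -> X} := fun a => nth 0 (l t) a.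
  pose L0 : {ptws 'I_(size l0) -> X} := fun a => nth 0 l0 a.
  apply: (cvg_within_cvg (u := fun t => (z t, L t)) (u0 := (z0, L0)) cdf) => //.
    apply: (@cvg_pair _ _ _ FF (nbhs z0) (nbhs L0)) => //.
    exact: ptws_cvg.
  by apply: filterS Pz => t Pt; split.
- move=> l k z lr Pz.
  have lr' := le_diff_orderW (leqnSn _) lr.
  have lr2 : le_diff_order (size (rcons l k)) r by rewrite size_rcons.
  rewrite Gint// iter_derive_rcons.
  have := Gder _ lr2 => /iter_derivable_rcons[_ /(_ _ Pz) /dir_deriveP].
  apply: (@is_dir_derive_near _ _ _ P°); first exact: nbhs_interior.
  by move=> w Pw; rewrite Gint.
Qed.


End CrJet.

Section CrsJet.
Context {R : realType} {E1 E2 F : tvsType R}.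

(** The derivatives in the second variable are taken first, so they form a jet only
as long as there is no direction in the first variable; once they are taken, the
remaining ones form a jet in the first variable. *)
Lemma Crs_jet (r s : diff_order) (U : set E1) (V : set E2) (f : E1 * E2 -> F) :
  Crs r s U V f ->
  exists D : seq E1 -> seq E2 -> E1 * E2 -> F, [/\
    forall (T : Type) (G : set_system T), Filter G ->
      forall l l0 m m0 (z : T -> E1 * E2) z0,
      le_diff_order (size l0) r -> le_diff_order (size m0) s ->
      cvg_seq G l l0 -> cvg_seq G m m0 -> z @ G --> z0 ->
      (\forall t \near G, (U `*` V) (z t)) -> (U `*` V) z0 ->
      D (l t) (m t) (z t) @[t --> G] --> D l0 m0 z0,
    jet (fun v => (0, v)) (U `*` V) s (D [::]),
    forall m, le_diff_order (size m) s ->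
      jet (fun w => (w, 0)) (U `*` V) r (D^~ m) &
    forall z, (U `*` V) z -> D [::] [::] z = f z].
Proof.
move=> [fo fx].
have {}fx i j : exists df :
    (E1 * E2) * ({ptws 'I_i -> E1} * {ptws 'I_j -> E2}) -> F,
   le_diff_order i r -> le_diff_order j s ->
   [/\ {within (U `*` V) `*` setT, continuous df},
          forall x y u, U° x -> V° y -> df ((x, y), u) = dij f ((x, y), u) &
          i = 0%N -> j = 0%N ->
            forall x y u, U x -> V y -> df ((x, y), u) = f (x, y)].
  have [ir|ir] := boolP (le_diff_order i r); last by exists (fun=> 0).
  have [js|js] := boolP (le_diff_order j s); last by exists (fun=> 0).
  by have [df dfP] := fx i j ir js; exists df.
have [df dfP] := choice_dep (fun i => choice_dep (fx i)).
pose D l m z := df (size l) (size m)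
  (z, (fun a : 'I_(size l) => nth 0 l a, fun a : 'I_(size m) => nth 0 m a)).
have Dcvg (T : Type) (G : set_system T) : Filter G ->
      forall l l0 m m0 (z : T -> E1 * E2) z0,
      le_diff_order (size l0) r -> le_diff_order (size m0) s ->
      cvg_seq G l l0 -> cvg_seq G m m0 -> z @ G --> z0 ->
      (\forall t \near G, (U `*` V) (z t)) -> (U `*` V) z0 ->
      D (l t) (m t) (z t) @[t --> G] --> D l0 m0 z0.
  move=> FG l l0 m m0 z z0 l0r m0s [sl cl] [sm cm] zz Uz Uz0.
  rewrite /D; under eq_fun do rewrite sl sm.
  have [cdf _ _] := dfP _ _ l0r m0s.
  pose L t : {ptws 'I_(size l0) -> E1} := fun a => nth 0 (l t) a.
  pose L0 : {ptws 'I_(size l0) -> E1} := fun a => nth 0 l0 a.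
  pose M t : {ptws 'I_(size m0) -> E2} := fun a => nth 0 (m t) a.
  pose M0 : {ptws 'I_(size m0) -> E2} := fun a => nth 0 m0 a.
  apply: (cvg_within_cvg (u := fun t => (z t, (L t, M t)))
    (u0 := (z0, (L0, M0))) cdf) => //.
    apply: (@cvg_pair _ _ _ G (nbhs z0) (nbhs (L0, M0))) => //.
    by apply: (@cvg_pair _ _ _ G (nbhs L0) (nbhs M0)); exact: ptws_cvg.
  by apply: filterS Uz => t Ut; split.
have UV z : (U `*` V)° z -> U° z.1 /\ V° z.2.
  move=> [[A B] /= [nA nB] AB]; split.
    apply: filterS nA => x Ax.
    by have [] := AB (x, z.2) (conj Ax (nbhs_singleton nB)).
  apply: filterS nB => x Bx.
  by have [] := AB (z.1, x) (conj (nbhs_singleton nA) Bx).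
have oUV z : U° z.1 -> V° z.2 -> nbhs z (U° `*` V°).
  by move=> Uz Vz; exists (U°, V°) => //=; split; exact: nbhs_interior.
pose dirs (l : seq E1) (m : seq E2) : seq (E1 * E2) :=
  [seq (0, v) | v <- m] ++ [seq (w, 0) | w <- l].
have dirsE l m : dij_dirs (fun a : 'I_(size l) => nth 0 l a)
    (fun a : 'I_(size m) => nth 0 m a) = dirs l m.
  rewrite /dij_dirs /dirs (map_nth_ord 0 (fun v => (0, v))).
  by rewrite (map_nth_ord 0 (fun w => (w, 0))).
have Dint l m z : le_diff_order (size l) r -> le_diff_order (size m) s ->
    U° z.1 -> V° z.2 -> D l m z = iter_derive (dirs l m) f z.
  move=> lr ms Uz Vz; have [_ + _] := dfP _ _ lr ms.
  by case: z Uz Vz => x y Ux Vy dfE; rewrite /D dfE// /dij /= dirsE.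
have Dder l m : le_diff_order (size l) r -> le_diff_order (size m) s ->
    iter_derivable (U° `*` V°) (dirs l m) f.
  move=> lr ms; have [+ _] := fo _ _ lr ms.
  move=> /(_ (fun a : 'I_(size l) => nth 0 l a)
    (fun a : 'I_(size m) => nth 0 m a)).
  by rewrite dirsE.
have r0 : le_diff_order 0 r by case: (r).
have s0 : le_diff_order 0 s by case: (s).
exists D; split => //.
- split.
    move=> T G FG m m0 z z0 m0s mm zz Uz Uz0.
    by apply: Dcvg => //; exact: cvg_seq_cst.
  move=> m v z ms /UV[Uz Vz].
  have ms' := le_diff_orderW (leqnSn _) ms.
  have ms2 : le_diff_order (size (rcons m v)) s by rewrite size_rcons.
  have dE : dirs [::] (rcons m v) = rcons (dirs [::] m) (0, v).
    by rewrite /dirs /= !cats0 map_rcons.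
  rewrite Dint// dE iter_derive_rcons.
  have := Dder [::] _ r0 ms2; rewrite dE.
  move=> /iter_derivable_rcons[_ /(_ z (conj Uz Vz)) /dir_deriveP].
  apply: (@is_dir_derive_near _ _ _ (U° `*` V°)); first exact: oUV.
  by move=> w [Uw Vw]; rewrite Dint.
- move=> m ms; split.
    move=> T G FG l l0 z z0 l0r ll zz Uz Uz0.
    by apply: Dcvg => //; exact: cvg_seq_cst.
  move=> l w z lr /UV[Uz Vz].
  have lr' := le_diff_orderW (leqnSn _) lr.
  have lr2 : le_diff_order (size (rcons l w)) r by rewrite size_rcons.
  have dE : dirs (rcons l w) m = rcons (dirs l m) (w, 0).
    by rewrite /dirs /= map_rcons rcons_cat.
  rewrite Dint// dE iter_derive_rcons.
  have := Dder _ _ lr2 ms; rewrite dE.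
  move=> /iter_derivable_rcons[_ /(_ z (conj Uz Vz)) /dir_deriveP].
  apply: (@is_dir_derive_near _ _ _ (U° `*` V°)); first exact: oUV.
  by move=> y [Uy Vy]; rewrite Dint.
- move=> [x y] [/= Ux Vy]; have [_ _ h] := dfP 0%N 0%N r0 s0.
  by rewrite /D /= h.
Qed.

End CrsJet.

(** * The composition *)

Section ProductSets.
Context {R : realType} {E1 E2 : tvsType R} (U : set E1) (V : set E2).

Lemma locally_convex_setX : locally_convex_set U -> locally_convex_set V ->
  locally_convex_set (U `*` V).
Proof.
move=> cU cV [x y] [/= Ux Vy].
have [A [AU nA cA]] := cU _ Ux; have [B [BV nB cB]] := cV _ Vy.
exists (A `*` B); split.
- by move=> z [/AU ? /BV ?]; split.
- rewrite nbhs_prodX_subspace_inE//; exists (A, B) => //.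
- move=> z z' t; rewrite !inE => -[Az Bz] [Az' Bz']; split.
    by apply/set_mem/cA; exact/mem_set.
  by apply/set_mem/cB; exact/mem_set.
Qed.

Lemma dense_interiorX : dense_interior U -> dense_interior V ->
  dense_interior (U `*` V).
Proof.
move=> dU dV [x y] [/= Ux Vy] W [[A B] /= [nA nB] AB].
have [a [Ua Aa]] := dU _ Ux _ nA; have [b [Vb Bb]] := dV _ Vy _ nB.
exists (a, b); split; last by apply: AB.
by exists (U, V) => //=; split.
Qed.

End ProductSets.

Section Composition.
Context {R : realType} {X1 X2 E1 E2 F : tvsType R}.
Context (P : set X1) (Q : set X2) (U : set E1) (V : set E2) (r s : diff_order).
Context (D : seq E1 -> seq E2 -> E1 * E2 -> F).
Context (G1 : seq X1 -> X1 -> E1) (G2 : seq X2 -> X2 -> E2).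
Hypothesis hF : hausdorff_space F.
Hypothesis cUV : locally_convex_set (U `*` V).
Hypothesis dUV : dense_interior (U `*` V).
Hypothesis D_cvg : forall (T : Type) (G : set_system T), Filter G ->
      forall l l0 m m0 (z : T -> E1 * E2) z0,
      le_diff_order (size l0) r -> le_diff_order (size m0) s ->
      cvg_seq G l l0 -> cvg_seq G m m0 -> z @ G --> z0 ->
      (\forall t \near G, (U `*` V) (z t)) -> (U `*` V) z0 ->
      D (l t) (m t) (z t) @[t --> G] --> D l0 m0 z0.
Hypothesis D_jet2 : jet (fun v => (0, v)) (U `*` V) s (D [::]).
Hypothesis D_jet1 : forall m, le_diff_order (size m) s ->
  jet (fun w => (w, 0)) (U `*` V) r (D^~ m).
Hypothesis G1_jet : jet id P r G1.
Hypothesis G2_jet : jet id Q s G2.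
Hypothesis G1U : forall x, P x -> U (G1 [::] x).
Hypothesis G2V : forall x, Q x -> V (G2 [::] x).

(** The directions are given by infinite sequences so that the formulas for
successive i and j share their directions. *)
Definition faa_di_bruno (i j : nat) (w : nat -> X1) (v : nat -> X2)
    (z : X1 * X2) : F :=
  \sum_(p <- set_parts i) \sum_(q <- set_parts j)
    D [seq G1 [seq w n | n <- B] z.1 | B <- p]
      [seq G2 [seq v n | n <- B] z.2 | B <- q]
      (G1 [::] z.1, G2 [::] z.2).

Lemma faa_di_bruno_cvg (T : Type) (G : set_system T) : Filter G ->
  forall i j (w : T -> nat -> X1) w0 (v : T -> nat -> X2) v0
    (z : T -> X1 * X2) z0,
  le_diff_order i r -> le_diff_order j s ->
  (forall n, w t n @[t --> G] --> w0 n) ->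
  (forall n, v t n @[t --> G] --> v0 n) ->
  z @ G --> z0 -> (\forall t \near G, (P `*` Q) (z t)) -> (P `*` Q) z0 ->
  faa_di_bruno i j (w t) (v t) (z t) @[t --> G] --> faa_di_bruno i j w0 v0 z0.
Proof.
move=> FG i j w w0 v v0 z z0 ir js ww vv zz PQ [Pz Qz].
have z1 : (z t).1 @[t --> G] --> z0.1 by exact: (cvg_comp _ _ zz cvg_fst).
have z2 : (z t).2 @[t --> G] --> z0.2 by exact: (cvg_comp _ _ zz cvg_snd).
have Pn : \forall t \near G, P (z t).1 by apply: filterS PQ => t [].
have Qn : \forall t \near G, Q (z t).2 by apply: filterS PQ => t [].
have G1cvg B : (size B <= i)%N -> G1 [seq w t n | n <- B] (z t).1 @[t --> G] -->
    G1 [seq w0 n | n <- B] z0.1.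
  move=> Bi; apply: (jet_cvg G1_jet) => //.
    by rewrite size_map; exact: le_diff_orderW ir.
  exact: (cvg_seq_map (c := fun n t => w t n)).
have G2cvg B : (size B <= j)%N -> G2 [seq v t n | n <- B] (z t).2 @[t --> G] -->
    G2 [seq v0 n | n <- B] z0.2.
  move=> Bj; apply: (jet_cvg G2_jet) => //.
    by rewrite size_map; exact: le_diff_orderW js.
  exact: (cvg_seq_map (c := fun n t => v t n)).
apply: (cvg_sumv (f := fun p t => \sum_(q <- set_parts j)
    D [seq G1 [seq w t n | n <- B] (z t).1 | B <- p]
      [seq G2 [seq v t n | n <- B] (z t).2 | B <- q]
      (G1 [::] (z t).1, G2 [::] (z t).2))) => p /set_parts_bound[sp bp].
apply: (cvg_sumv (f := fun q t =>
    D [seq G1 [seq w t n | n <- B] (z t).1 | B <- p]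
      [seq G2 [seq v t n | n <- B] (z t).2 | B <- q]
      (G1 [::] (z t).1, G2 [::] (z t).2))) => q /set_parts_bound[sq bq].
apply: D_cvg.
- by rewrite size_map; exact: le_diff_orderW ir.
- by rewrite size_map; exact: le_diff_orderW js.
- apply: (cvg_seq_map (c := fun B t => G1 [seq w t n | n <- B] (z t).1)) => B Bp.
  exact/G1cvg/bp.
- apply: (cvg_seq_map (c := fun B t => G2 [seq v t n | n <- B] (z t).2)) => B Bq.
  exact/G2cvg/bq.
- apply: (@cvg_pair _ _ _ G (nbhs (G1 [::] z0.1)) (nbhs (G2 [::] z0.2))).
    exact: (G1cvg [::]).
  exact: (G2cvg [::]).
- by apply: filterS2 Pn Qn => t Pt Qt; split; [exact: G1U|exact: G2V].
- by split; [exact: G1U|exact: G2V].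
Qed.

(** The first component of z may lie on the boundary of P, and the values of G1 and
G2 on the boundary of U and V. *)
Lemma faa_di_bruno_derive2 j w v z : le_diff_order j.+1 s -> P z.1 -> Q° z.2 ->
  is_dir_derive (faa_di_bruno 0 j w v) z (0, v j) (faa_di_bruno 0 j.+1 w v z).
Proof.
move=> js Pz Qz.
pose c B t := G2 [seq v n | n <- B] (z.2 + t *: v j).
have c0 B : c B 0 = G2 [seq v n | n <- B] z.2 by rewrite /c scale0r addr0.
have cder B : (size B <= j)%N ->
    t^-1 *: (c B t - c B 0) @[t --> 0^'] --> c (rcons B j) 0.
  move=> Bj; rewrite !c0 map_rcons.
  apply: (jet_derive G2_jet) => //; rewrite size_map.
  exact: le_diff_orderW js.
have iD : {morph (fun y : E2 => (0, y) : E1 * E2) : x y / x + y}.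
  by move=> x y; congr pair; rewrite addr0.
have iZ a : {morph (fun y : E2 => (0, y) : E1 * E2) : x / a *: x}.
  by move=> x; congr pair; rewrite scaler0.
have ic : continuous (fun y : E2 => (0, y) : E1 * E2).
  move=> y; apply: (@cvg_pair _ _ _ (nbhs y) (nbhs (0 : E1)) (nbhs y)).
    exact: cvg_cst.
  exact: cvg_id.
have eE t : (G1 [::] z.1, 0) + (0, c [::] t) = (G1 [::] z.1, c [::] t).
  by congr pair; rewrite ?addr0 ?add0r.
have sE t k : \sum_(p <- set_parts k)
    D [::] [seq c B t | B <- p] ((G1 [::] z.1, 0) + (0, c [::] t)) =
    faa_di_bruno 0 k w v (z + t *: (0, v j)).
  by rewrite /faa_di_bruno big_seq1 eE /= scaler0 addr0.
have St : \forall t \near (0 : R)^', (U `*` V) ((G1 [::] z.1, 0) + (0, c [::] t)).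
  apply: filterS (near_shift_dir (v j) Qz) => t Qt.
  by rewrite eE; split; [exact: G1U|exact: G2V].
have S0 : (U `*` V) ((G1 [::] z.1, 0) + (0, c [::] 0)).
  by rewrite eE c0; split; [exact: G1U|apply: G2V; exact: interior_subset].
have := set_parts_chain_cvg hF cUV dUV iD iZ ic D_jet2 js cder St S0.
rewrite !sE scale0r addr0; apply: cvg_trans; apply: near_eq_cvg; apply: nearW => t.
by rewrite /diff_quotient sE.
Qed.

Lemma faa_di_bruno_derive1 i j w v z : le_diff_order i.+1 r -> le_diff_order j s ->
  P° z.1 -> Q z.2 ->
  is_dir_derive (faa_di_bruno i j w v) z (w i, 0) (faa_di_bruno i.+1 j w v z).
Proof.
move=> ir js Pz Qz.
pose c B t := G1 [seq w n | n <- B] (z.1 + t *: w i).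
have c0 B : c B 0 = G1 [seq w n | n <- B] z.1 by rewrite /c scale0r addr0.
have cder B : (size B <= i)%N ->
    t^-1 *: (c B t - c B 0) @[t --> 0^'] --> c (rcons B i) 0.
  move=> Bi; rewrite !c0 map_rcons.
  apply: (jet_derive G1_jet) => //; rewrite size_map.
  exact: le_diff_orderW ir.
have iD : {morph (fun x : E1 => (x, 0) : E1 * E2) : x y / x + y}.
  by move=> x y; congr pair; rewrite addr0.
have iZ a : {morph (fun x : E1 => (x, 0) : E1 * E2) : x / a *: x}.
  by move=> x; congr pair; rewrite scaler0.
have ic : continuous (fun x : E1 => (x, 0) : E1 * E2).
  move=> x; apply: (@cvg_pair _ _ _ (nbhs x) (nbhs x) (nbhs (0 : E2))).
    exact: cvg_id.
  exact: cvg_cst.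
have eE t : (0, G2 [::] z.2) + (c [::] t, 0) = (c [::] t, G2 [::] z.2).
  by congr pair; rewrite ?addr0 ?add0r.
pose m q := [seq G2 [seq v n | n <- B] z.2 | B <- q].
have sE t k : \sum_(q <- set_parts j) \sum_(p <- set_parts k)
    D [seq c B t | B <- p] (m q) ((0, G2 [::] z.2) + (c [::] t, 0)) =
    faa_di_bruno k j w v (z + t *: (w i, 0)).
  by rewrite exchange_big /faa_di_bruno eE /= scaler0 addr0.
have St : \forall t \near (0 : R)^', (U `*` V) ((0, G2 [::] z.2) + (c [::] t, 0)).
  apply: filterS (near_shift_dir (w i) Pz) => t Pt.
  by rewrite eE; split; [exact: G1U|exact: G2V].
have S0 : (U `*` V) ((0, G2 [::] z.2) + (c [::] 0, 0)).
  by rewrite eE c0; split; [apply: G1U; exact: interior_subset|exact: G2V].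
have ms q : q \in set_parts j -> le_diff_order (size (m q)) s.
  by move=> /set_parts_bound[sq _]; rewrite size_map; exact: le_diff_orderW js.
pose Sum k q t := \sum_(p <- set_parts k)
    D [seq c B t | B <- p] (m q) ((0, G2 [::] z.2) + (c [::] t, 0)).
have := @cvg_sumv _ _ ((0 : R)^') (dnbhs_filter _) F _ (set_parts j)
  (fun q t => t^-1 *: (Sum i q t - Sum i q 0)) (Sum i.+1 ^~ 0) (fun q qj =>
  set_parts_chain_cvg hF cUV dUV iD iZ ic (D_jet1 (ms q qj)) ir cder St S0).
rewrite !sE scale0r addr0; apply: cvg_trans; apply: near_eq_cvg; apply: nearW => t.
by rewrite /diff_quotient -scaler_sumr sumrB !sE scale0r addr0.
Qed.

Lemma iter_derive_comp (f : E1 * E2 -> F) (g1 : X1 -> E1) (g2 : X2 -> E2)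
    i j w v :
  (forall z, (U `*` V) z -> D [::] [::] z = f z) ->
  (forall x, P x -> G1 [::] x = g1 x) -> (forall x, Q x -> G2 [::] x = g2 x) ->
  le_diff_order i r -> le_diff_order j s ->
  let hs := [seq (0, v n) | n <- iota 0 j] ++ [seq (w n, 0) | n <- iota 0 i] in
  let fg := fun z => f (g1 z.1, g2 z.2) in
  iter_derivable (P° `*` Q°) hs fg /\
  forall z, (P° `*` Q°) z -> iter_derive hs fg z = faa_di_bruno i j w v z.
Proof.
move=> Df G1g G2g ir js hs fg; rewrite {}/hs.
have oPQ : open (P° `*` Q°).
  rewrite openE => z [Pz Qz]; exists (P°, Q°) => //=.
  by split; exact: nbhs_interior.
have iotaS n : iota 0 n.+1 = rcons (iota 0 n) n by rewrite -cats1 -addn1 iotaD.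
elim: i ir => [_|i ih ir].
  rewrite /= cats0; elim: j js => [_|j ih js].
    split => // z [/interior_subset Pz /interior_subset Qz].
    rewrite /= /faa_di_bruno !big_seq1 /= Df ?G1g ?G2g//.
    by split; rewrite /= -?G1g -?G2g//; [exact: G1U|exact: G2V].
  have [dj ej] := ih (le_diff_orderW (leqnSn _) js).
  rewrite iotaS map_rcons; apply: (iter_derive_step hF oPQ dj ej) => z [Pz Qz].
  by apply: faa_di_bruno_derive2 => //; exact: interior_subset.
have [di ei] := ih (le_diff_orderW (leqnSn _) ir).
rewrite iotaS map_rcons -rcons_cat.
apply: (iter_derive_step hF oPQ di ei) => z [Pz Qz].
by apply: faa_di_bruno_derive1 => //; exact: interior_subset.
Qed.

End Composition.

Theorem lemma3p17 (R : realType) (X1 X2 E1 E2 F : tvsType R)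
  (hX1 : hausdorff_space X1) (hX2 : hausdorff_space X2)
  (hE1 : hausdorff_space E1) (hE2 : hausdorff_space E2)
  (hF : hausdorff_space F)
  (P : set X1) (Q : set X2) (U : set E1) (V : set E2)
  (cP : locally_convex_set P) (dP : dense_interior P)
  (cQ : locally_convex_set Q) (dQ : dense_interior Q)
  (cU : locally_convex_set U) (dU : dense_interior U)
  (cV : locally_convex_set V) (dV : dense_interior V)
  (r s : diff_order)
  (f : E1 * E2 -> F) (g1 : X1 -> E1) (g2 : X2 -> E2)
  (fC : Crs r s U V f)
  (g1U : forall p, P p -> U (g1 p)) (g1C : Cr r P g1)
  (g2V : forall q, Q q -> V (g2 q)) (g2C : Cr s Q g2) :
  Crs r s P Q (fun z => f (g1 z.1, g2 z.2)).
Proof.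
have [D [Dcvg D2 D1 Df]] := Crs_jet fC.
have [G1 jG1 G1g] := Cr_jet g1C.
have [G2 jG2 G2g] := Cr_jet g2C.
have G1U x : P x -> U (G1 [::] x) by move=> Px; rewrite G1g//; exact: g1U.
have G2V x : Q x -> V (G2 [::] x) by move=> Qx; rewrite G2g//; exact: g2V.
have cUV := locally_convex_setX cU cV.
have dUV := dense_interiorX dU dV.
(* A finite family of directions, continued by 0. *)
pose ext (X : tvsType R) k (y : {ptws 'I_k -> X}) n : X := oapp y 0 (insub n).
have ext_map (X : tvsType R) (Y : Type) (h : X -> Y) k (y : {ptws 'I_k -> X}) :
    [seq h (y a) | a : 'I_k] = [seq h (ext X k y n) | n <- iota 0 k].
  rewrite -val_enum_ord -map_comp; apply: eq_map => a /=.
  by rewrite /ext valK.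
have ext_cvg (X : tvsType R) k n (T : Type) (G : set_system T) (FG : Filter G)
    (y : T -> {ptws 'I_k -> X}) (y0 : {ptws 'I_k -> X}) :
    y t @[t --> G] --> y0 -> ext X k (y t) n @[t --> G] --> ext X k y0 n.
  move=> yy; rewrite /ext; case: insubP => [a _ _|_] /=; last exact: cvg_cst.
  exact: (cvg_comp _ _ yy (@proj_continuous _ _ a y0)).
pose dF i j (u : (X1 * X2) * ({ptws 'I_i -> X1} * {ptws 'I_j -> X2})) :=
  faa_di_bruno D G1 G2 i j (ext _ _ u.2.1) (ext _ _ u.2.2) u.1.
have dF_dirs i j (w : {ptws 'I_i -> X1}) (v : {ptws 'I_j -> X2}) :
    dij_dirs w v = [seq (0, ext _ _ v n) | n <- iota 0 j] ++
                   [seq (ext _ _ w n, 0) | n <- iota 0 i].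
  rewrite /dij_dirs (ext_map _ _ (fun v => (0, v))).
  by rewrite (ext_map _ _ (fun w => (w, 0))).
have dFE i j z : le_diff_order i r -> le_diff_order j s ->
    P° z.1.1 -> Q° z.1.2 ->
    dij (fun z => f (g1 z.1, g2 z.2)) z = dF i j z.
  move=> ir js Pz Qz; rewrite /dij dF_dirs.
  have [_ h] := iter_derive_comp hF cUV dUV D2 D1 jG1 jG2 G1U G2V
    (ext _ _ z.2.1) (ext _ _ z.2.2) Df G1g G2g ir js.
  exact: h.
have dF_cont i j : le_diff_order i r -> le_diff_order j s ->
    {within (P `*` Q) `*` setT, continuous (dF i j)}.
  move=> ir js; apply/subspace_continuousP => u [PQu _].
  have cont (Y : topologicalType)
      (h : (X1 * X2) * ({ptws 'I_i -> X1} * {ptws 'I_j -> X2}) -> Y) :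
      h x @[x --> u] --> h u ->
      h x @[x --> within ((P `*` Q) `*` setT) (nbhs u)] --> h u.
    exact: cvg_within_filter.
  have fst_u : fst x @[x --> u] --> fst u by exact: cvg_fst.
  have snd_u : snd x @[x --> u] --> snd u by exact: cvg_snd.
  apply: (@faa_di_bruno_cvg _ _ _ _ _ _ _ _ _ _ _ _ _ _ _ Dcvg jG1 jG2 G1U G2V _
    (within ((P `*` Q) `*` setT) (nbhs u)) (within_filter _ _) i j
    (fun x => ext _ _ x.2.1) (ext _ _ u.2.1)
    (fun x => ext _ _ x.2.2) (ext _ _ u.2.2) fst u.1 ir js) => //.
  - move=> n; apply: ext_cvg; apply: (cont _ (fun x => x.2.1)).
    exact: (cvg_comp _ _ snd_u cvg_fst).
  - move=> n; apply: ext_cvg; apply: (cont _ (fun x => x.2.2)).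
    exact: (cvg_comp _ _ snd_u cvg_snd).
  - exact: cont.
  - by apply: filterS (withinT _ _) => x [].
split.
- move=> i j ir js; split.
    move=> w v; rewrite dF_dirs.
    by have [] := iter_derive_comp hF cUV dUV D2 D1 jG1 jG2 G1U G2V
      (ext _ _ w) (ext _ _ v) Df G1g G2g ir js.
  apply: (@subspace_eq_continuous _ _ _ (dF i j)).
    by move=> [[x y] u] /set_mem[[Px Qy] _]; rewrite /from_subspace dFE.
  apply: continuous_subspaceW (dF_cont i j ir js) => x [[Px Qx] _].
  by split => //; split; exact: interior_subset.
- move=> i j ir js; exists (dF i j); split.
  + exact: dF_cont.
  + by move=> x y u Px Qy; rewrite dFE.
  + move=> i0 j0 x y u Px Qy; move: u; rewrite i0 j0 => u.
    rewrite /dF /faa_di_bruno !big_seq1 /= Df ?G1g ?G2g//.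
    by split; rewrite /= -?G1g -?G2g//; [exact: G1U|exact: G2V].
Qed.
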